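(* Catalan inversion sequences grow according to the following succession rule: \[\Omega_{Cat_2}=\left\{\begin{array}{l}(1,1)\\ (h,k)\rightsquigarrow (0,k+1)^h,\ (h+1,k),(h+2,k-1),\ldots,(h+k,1).\end{array}\right.\]
   Context: An inversion sequence of length (size) $n\ge 1$ is an integer sequence $e=(e_1,\ldots,e_n)$ with $0\le e_i<i$ for all $i$. A Catalan inversion sequence is an element of $\mathbf{I}(\geq,-,\geq)$, i.e. an inversion sequence with no three indices $i<j<k$ such that $e_i\ge e_j$ and $e_i\ge e_k$. A generating tree for a combinatorial class $\mathcal{C}$ (with finitely many objects of each size and exactly one object of size $1$) is an infinite rooted tree whose vertices are the objects of $\mathcal{C}$, each appearing exactly once, with objects of size $n$ at level $n$ (the root being at level $1$); the children of an object $c$ are obtained by adding to $c$ an atom (a piece of object increasing the size by $1$) following some prescribed rules. A succession rule consists of a starting label (the axiom) and, for each label, a multiset of produced labels (its productions). The class $\mathcal{C}$ grows according to a succession rule $\Omega$ if there are a generating tree for $\mathcal{C}$ and an assignment of labels to the objects of $\mathcal{C}$ such that the root carries the axiom and, for each object with label $\ell$, the multiset of labels of its children is exactly the multiset of productions of $\ell$ in $\Omega$. An exponent on a label denotes multiplicity. In the rule above, the axiom is $(1,1)$ and label $(h,k)$ produces $(0,k+1)$ with multiplicity $h$, and $(h+i,k+1-i)$ once for each $1\le i\le k$. *)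

(* Defs.v *)
From mathcomp Require Import all_boot.
Set Implicit Arguments.
Unset Strict Implicit.
Unset Printing Implicit Defensive.

(* [add_atom c c'] reads: c' is obtained from c by adding one atom to it. *)
Record combinatorial_class := CombinatorialClass {
  object :> eqType;
  osize : object -> nat;
  add_atom : object -> object -> Prop;
  osize_gt0 : forall c, 0 < osize c;
  osize_finite : forall n, exists s : seq object, forall c, osize c = n -> c \in s;
  osize1_unique : exists! c, osize c = 1;
  osize_add_atom : forall c c', add_atom c c' -> osize c' = (osize c).+1 }.

Section GeneratingTrees.

Variable C : combinatorial_class.

(* The vertices n edges away from the root, listed with repetitions; levels
   being numbered from 1, this is level n + 1. *)
Definition vertices_at_depth (root : C) (children : C -> seq C) (n : nat) : seq C :=
  iter n (fun s => flatten [seq children c | c <- s]) [:: root].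

(* The function [children] plays the role of the prescribed rules. Each object
   of size n occurs exactly once at level n and at no other level. *)
Definition generating_tree (root : C) (children : C -> seq C) : Prop :=
  (forall c c', c' \in children c -> add_atom c c') /\
  (forall n, uniq (vertices_at_depth root children n) /\
    forall c, (c \in vertices_at_depth root children n) = (osize c == n.+1)).

End GeneratingTrees.

(* The list [production l] represents a multiset. *)
Record succession_rule := SuccessionRule {
  label : eqType;
  rule_axiom : label;
  production : label -> seq label }.

Definition grows_according_to (C : combinatorial_class) (Omega : succession_rule) : Prop :=
  exists (root : C) (children : C -> seq C) (lab : C -> label Omega),
    [/\ generating_tree root children,
        lab root = rule_axiom Omega
      & forall c, perm_eq [seq lab c' | c' <- children c] (production (lab c))].

(* Positions are numbered from 0, so that e_i is [nth 0 e i.-1] and the bound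
   e_i < i becomes [nth 0 e i <= i]. *)
Definition inversion_sequence (e : seq nat) : bool :=
  (0 < size e) && [forall i : 'I_(size e), nth 0 e i <= i].

Definition avoids_ge_any_ge (e : seq nat) : bool :=
  ~~ [exists i : 'I_(size e), exists j : 'I_(size e), exists k : 'I_(size e),
       [&& i < j, j < k, nth 0 e i >= nth 0 e j & nth 0 e i >= nth 0 e k]].

Definition catalan_inversion_sequence (e : seq nat) : bool :=
  inversion_sequence e && avoids_ge_any_ge e.

Definition catalan_seq : eqType := {e : seq nat | catalan_inversion_sequence e}.

(* The atoms of an inversion sequence are its entries: adding one means
   inserting an entry at any position, the other entries being unchanged. *)
Definition insert_entry (e e' : seq nat) : Prop :=
  exists i x, i <= size e /\ e' = take i e ++ x :: drop i e.

Lemma catalan_size_gt0 (c : catalan_seq) : 0 < size (val c).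
Proof. by case: c => e /= /andP[/andP[]]. Qed.

Lemma catalan_finite n :
  exists s : seq catalan_seq, forall c : catalan_seq, size (val c) = n -> c \in s.
Proof.
exists (pmap insub [seq map (@nat_of_ord n) t | t : n.-tuple 'I_n]) => c sz_c.
rewrite mem_pmap_sub /=; case: n sz_c => [|n] sz_c.
  by move: (catalan_size_gt0 c); rewrite sz_c.
have sz_t : size (map (@inord n) (val c)) == n.+1 by rewrite size_map sz_c.
apply/mapP; exists (Tuple sz_t); first by rewrite mem_enum.
rewrite /= -map_comp -[LHS]map_id; apply/eq_in_map => x /(nthP 0)[i lt_i <-] /=.
rewrite inordK //; case/andP: (valP c) => /andP[_ /forallP/(_ (Ordinal lt_i))] /= le_i _.
by rewrite -sz_c (leq_ltn_trans le_i).
Qed.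

Lemma catalan_seq0 : catalan_inversion_sequence [:: 0].
Proof.
apply/andP; split; first by apply/andP; split=> //; apply/forallP => -[[]].
by apply/existsP => -[[[|//] ?]] /existsP[[[|//] ?]] /existsP[? /andP[]].
Qed.

Lemma catalan_size1_unique : exists! c : catalan_seq, size (val c) = 1.
Proof.
exists (Sub [:: 0] catalan_seq0 : catalan_seq); split=> // c sz_c; apply: val_inj.
case: c sz_c => [[|x [|//]] //= cat_e] _.
by case/andP: cat_e => /andP[_ /forallP/(_ ord0)] /=; rewrite leqn0 => /eqP->.
Qed.

Lemma size_insert_entry (c c' : catalan_seq) :
  insert_entry (val c) (val c') -> size (val c') = (size (val c)).+1.
Proof.
case=> i [x [_ ->]].
by rewrite size_cat /= addnS -size_cat cat_take_drop.
Qed.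

Definition catalan_inversion_sequences : combinatorial_class :=
  @CombinatorialClass catalan_seq (fun c => size (val c))
    (fun c c' => insert_entry (val c) (val c'))
    catalan_size_gt0 catalan_finite catalan_size1_unique size_insert_entry.

Definition Omega_Cat2 : succession_rule :=
  @SuccessionRule (nat * nat)%type (1, 1)
    (fun '(h, k) => nseq h (0, k.+1) ++ [seq (h + i, k.+1 - i) | i <- iota 1 k]).

(* Main.v *)
Require Import Defs.
From mathcomp Require Import all_boot.
From mathcomp Require Import zify.
Set Implicit Arguments.
Unset Strict Implicit.
Unset Printing Implicit Defensive.

(** Grow a Catalan inversion sequence e of length n by appending a last entry x.
    The result is an inversion sequence when x <= n. A new forbidden pattern
    must use x as its third entry, so x has to exceed every entry that already
    has a smaller or equal entry somewhere to its right. Let f be the least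
    value meeting this constraint ([append_floor e]) and M the maximum of e.
    The admissible x are then f, ..., n ([catalan_rcons]). As f <= M + 1 and
    M < n, they split into h = M + 1 - f values that are at most M and
    k = n - M >= 1 values above M; the label of e is (h, k).

    If x <= M, the maximum is still M and now has x to its right, so the new
    floor is M + 1 and the label becomes (0, k + 1); this happens h times. If
    x = M + i with 1 <= i <= k, no entry of e is >= x, so the floor is
    unchanged while the maximum grows by i: the label becomes
    (h + i, k + 1 - i). This is the rule ([Cat2_label_appended]).

    Deleting the last entry of a Catalan inversion sequence of length at least
    2 leaves one, so each such sequence arises from exactly one parent, and
    [generating_tree_unique_parent] turns this into a generating tree. *)

(** Local uniqueness of parents is enough for the global condition on levels:
    by induction on the level, the blocks of children hanging from one level
    are pairwise disjoint and together exhaust the objects of the next size. *)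
Lemma generating_tree_unique_parent (C : combinatorial_class) (root : C)
    (children : C -> seq C) :
    osize root = 1 ->
    (forall c, uniq (children c)) ->
    (forall c c', c' \in children c -> add_atom c c') ->
    (forall c1 c2 c', c' \in children c1 -> c' \in children c2 -> c1 = c2) ->
    (forall c', 1 < osize c' -> exists c, c' \in children c) ->
  generating_tree root children.
Proof.
move=> root1 uniq_ch atom_ch inj_ch surj_ch; split=> // n.
have [r0 [_ r0_uniq]] := osize1_unique C.
elim: n => [|n [IHu IHm]].
  split=> // c; rewrite /vertices_at_depth /= inE.
  apply/eqP/eqP => [-> //|c1].
  by rewrite -(r0_uniq _ c1) -(r0_uniq _ root1).
rewrite /vertices_at_depth iterS -/(vertices_at_depth root children n).
set s := vertices_at_depth root children n in IHu IHm *.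
split=> [|c'].
  (* Seen as a dependent product, the concatenation of the blocks is free of
     repetitions as soon as (parent, child) is determined by child. *)
  rewrite -[flatten _](_ : [seq y | x <- s, y <- children x] = _); last first.
    by congr flatten; apply: eq_map => x; rewrite map_id.
  apply: allpairs_uniq_dep => // -[x y] [x' y'] /=.
  move=> /allpairsPdep[a [b [_ b_a [-> eq_b]]]].
  move=> /allpairsPdep[a' [b' [_ b_a' [-> eq_b']]]] eq_yy'.
  move: eq_b eq_b' b_a b_a' => /= <- <-; rewrite -eq_yy' => ya ya'.
  by rewrite (inj_ch _ _ _ ya ya').
apply/flatten_mapP/eqP => [[c]|sz_c'].
  by rewrite IHm => /eqP sz_c /atom_ch /osize_add_atom ->; rewrite sz_c.
have [|c c'_c] := surj_ch c'; first by rewrite sz_c'.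
exists c => //; rewrite IHm -eqSS -sz_c'.
by rewrite (osize_add_atom (atom_ch _ _ c'_c)).
Qed.

Lemma count_gt1P (T : Type) (x0 : T) (a : pred T) (s : seq T) :
  reflect (exists i j, [/\ i < j, j < size s, a (nth x0 s i) & a (nth x0 s j)])
          (1 < count a s).
Proof.
elim: s => [|x s IHs] /=; first by right=> -[i [j []]].
apply: (iffP idP) => [|[[|i] [[|j] []]] //= lt_ij lt_js ai aj].
- case ax: (a x) => /=.
    rewrite add1n ltnS -has_count => /(has_nthP x0)[j lt_js aj].
    by exists 0, j.+1; split.
  rewrite add0n => /IHs[i [j [lt_ij lt_js ai aj]]].
  by exists i.+1, j.+1.
- rewrite ai add1n ltnS -has_count; apply/(has_nthP x0).
  by exists j.
- rewrite ltn_addl //; apply/IHs; by exists i, j.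
Qed.

(** Splitting off the first entry x: a pattern starting at x is a pair of
    later entries that are both <= x. This makes avoidance a condition on counts
    that can be handled by induction on the sequence. *)
Lemma avoids_cons (x : nat) (e : seq nat) :
  avoids_ge_any_ge (x :: e) = (count (geq x) e <= 1) && avoids_ge_any_ge e.
Proof.
rewrite /avoids_ge_any_ge leqNgt -negb_or; congr (~~ _).
apply/existsP/orP => [[[[|i] lt_i]]|[/(count_gt1P 0)|/existsP]].
- move=> /existsP[[[|j] lt_j]] /existsP[[[|k] lt_k]] /and4P[] //= _ lt_jk xj xk.
  by left; apply/(count_gt1P 0); exists j, k.
- move=> /existsP[[[|j] lt_j]] /existsP[[[|k] lt_k]] /and4P[] //= lt_ij lt_jk xj xk.
  right; apply/existsP; exists (Ordinal (lt_i : i < size e)).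
  apply/existsP; exists (Ordinal (lt_j : j < size e)).
  apply/existsP; exists (Ordinal (lt_k : k < size e)).
  exact/and4P.
- move=> [j [k [lt_jk lt_k xj xk]]]; exists ord0.
  have lt_j : j < size e by apply: ltn_trans lt_k.
  apply/existsP; exists (lift ord0 (Ordinal lt_j) : 'I_(size (x :: e))).
  apply/existsP; exists (lift ord0 (Ordinal lt_k) : 'I_(size (x :: e))).
  exact/and4P.
- move=> [i /existsP[j /existsP[k /and4P[lt_ij lt_jk ij ik]]]].
  exists (lift ord0 i); apply/existsP; exists (lift ord0 j : 'I_(size (x :: e))).
  by apply/existsP; exists (lift ord0 k : 'I_(size (x :: e))); exact/and4P.
Qed.

Lemma inversion_sequence_rcons (e : seq nat) (x : nat) :
  0 < size e ->
  inversion_sequence (rcons e x) = inversion_sequence e && (x <= size e).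
Proof.
rewrite /inversion_sequence size_rcons /= => -> /=.
apply/forallP/andP => [inv_ex|[/forallP inv_e le_x] [i lt_i] /=].
  split; last by move: (inv_ex ord_max); rewrite /= nth_rcons ltnn eqxx.
  apply/forallP => i; move: (inv_ex (widen_ord (leqnSn _) i)).
  by rewrite /= nth_rcons ltn_ord.
rewrite nth_rcons; case: ltngtP => [lt_ie|//|-> //].
exact: (inv_e (Ordinal lt_ie)).
Qed.

Definition max_entry (e : seq nat) : nat := \max_(x <- e) x.

(** The least strict upper bound of the entries y that have some later entry
    <= y, hence the least value that can be appended without completing a
    forbidden pattern. *)
Fixpoint append_floor (e : seq nat) : nat :=
  if e is x :: e' then
    maxn (if has (geq x) e' then x.+1 else 0) (append_floor e')
  else 0.

Lemma avoids_rcons (e : seq nat) (x : nat) :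
  avoids_ge_any_ge (rcons e x) = avoids_ge_any_ge e && (append_floor e <= x).
Proof.
elim: e => [|y e IHe] /=; first by rewrite avoids_cons !andbT.
rewrite !avoids_cons IHe -cats1 count_cat /= has_count geq_max.
rewrite addn0 /=.
case: avoids_ge_any_ge; rewrite ?andbF //= ?andbT.
by case: (ltnP 0); case: (leqP x y); lia.
Qed.

Lemma catalan_rcons (e : seq nat) (x : nat) :
  0 < size e ->
  catalan_inversion_sequence (rcons e x) =
  catalan_inversion_sequence e && (append_floor e <= x <= size e).
Proof.
move=> e_gt0; rewrite /catalan_inversion_sequence.
rewrite inversion_sequence_rcons // avoids_rcons.
by rewrite andbACA [(x <= _) && _]andbC.
Qed.

Lemma max_entry_cons (x : nat) (e : seq nat) :
  max_entry (x :: e) = maxn x (max_entry e).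
Proof. exact: big_cons. Qed.

(** Non-emptiness matters for x = 0, since the maximum of the empty sequence is
    0 by convention. *)
Lemma has_max_entry (e : seq nat) (x : nat) :
  0 < size e -> has (leq x) e = (x <= max_entry e).
Proof.
case: e => // y e _; elim: e y => [|z e IHe] y.
  by rewrite max_entry_cons /max_entry big_nil maxn0 /= orbF.
by rewrite max_entry_cons leq_max -IHe.
Qed.

Lemma append_floor_le (e : seq nat) : append_floor e <= (max_entry e).+1.
Proof.
elim: e => //= x e IHe; rewrite max_entry_cons -maxnSS geq_max.
by rewrite !leq_max IHe orbT; case: has; rewrite ?leqnn.
Qed.

Lemma max_entry_rcons (e : seq nat) (x : nat) :
  max_entry (rcons e x) = maxn (max_entry e) x.
Proof. by rewrite /max_entry -cats1 big_cat big_seq1. Qed.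

(** An appended x turns each entry y >= x into one with a later entry <= y. If
    there is such a y, then the maximum is one of them and fixes the new floor;
    otherwise the floor is unchanged. *)
Lemma append_floor_rcons (e : seq nat) (x : nat) :
  append_floor (rcons e x) =
  if has (leq x) e then (max_entry e).+1 else append_floor e.
Proof.
elim: e => //= y e IHe; rewrite IHe max_entry_cons has_rcons /=.
have := append_floor_le e; case: e {IHe} => [|z e] floor_e.
  by rewrite /= !orbF maxn0; case: ifP => // _; rewrite /max_entry big_nil maxn0.
rewrite has_max_entry //.
move: (append_floor _) (max_entry _) (has (geq y) _) floor_e => a m b le_am.
by case: (leqP x y) => lt_xy; case: (leqP x m) => lt_xm; case: b => /=; lia.
Qed.

Lemma max_entry_lt_size (e : seq nat) :
  inversion_sequence e -> max_entry e < size e.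
Proof.
move=> /andP[e_gt0 /forallP inv_e]; rewrite ltnNge -has_max_entry //.
apply/(has_nthP 0) => -[i lt_i le_size].
by have := inv_e (Ordinal lt_i); rewrite /= leqNgt (leq_trans lt_i).
Qed.

(** The numbers of admissible last entries that are at most the maximum of [e],
    and that are above it. *)
Definition Cat2_label (e : seq nat) : nat * nat :=
  ((max_entry e).+1 - append_floor e, size e - max_entry e).

Definition appended (e : seq nat) : seq (seq nat) :=
  [seq rcons e x | x <- iota (append_floor e) ((size e).+1 - append_floor e)].

(** In this form the right-hand side is an enumeration of the children, and the
    left-hand side shows that a child determines its parent. *)
Lemma mem_appended (e f : seq nat) : catalan_inversion_sequence e ->
  (rcons e (last 0 f) == f) && catalan_inversion_sequence f = (f \in appended e).
Proof.
move=> cat_e; have e_gt0 : 0 < size e by case/andP: cat_e => /andP[].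
apply/andP/mapP => [[/eqP <-]|[x]].
  rewrite catalan_rcons // cat_e => x_range; exists (last 0 f) => //.
  by rewrite mem_iota; lia.
rewrite mem_iota => x_range ->; rewrite last_rcons eqxx catalan_rcons //.
by rewrite cat_e; split=> //; lia.
Qed.

(** The admissible range is cut just above the maximum: the two parts give the
    two kinds of productions, in the order in which the rule lists them. *)
Lemma Cat2_label_appended (e : seq nat) : inversion_sequence e ->
  [seq Cat2_label f | f <- appended e] = production (s := Omega_Cat2) (Cat2_label e).
Proof.
move=> inv_e; have lt_M := max_entry_lt_size inv_e.
have e_gt0 : 0 < size e by case/andP: inv_e.
have le_f := append_floor_le e.
rewrite -map_comp /=.
have -> : (size e).+1 - append_floor e =
          ((max_entry e).+1 - append_floor e) + (size e - max_entry e) by lia.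
rewrite iotaD map_cat; congr (_ ++ _).
  rewrite -[X in nseq X _](size_iota (append_floor e)).
  rewrite -(size_map (Cat2_label \o rcons e)); apply/all_pred1P/allP => l /mapP[x].
  rewrite mem_iota => x_range -> /=; apply/eqP.
  rewrite /Cat2_label append_floor_rcons max_entry_rcons size_rcons.
  rewrite has_max_entry //; case: leqP => [le_x|]; last by lia.
  by congr pair; lia.
have -> : append_floor e + ((max_entry e).+1 - append_floor e) = max_entry e + 1
  by lia.
rewrite iotaDl -map_comp; apply/eq_in_map => i; rewrite mem_iota /= => i_range.
rewrite /Cat2_label append_floor_rcons max_entry_rcons size_rcons.
rewrite has_max_entry //; case: leqP => [|_]; first by lia.
by congr pair; lia.
Qed.

Definition catalan_root : catalan_seq := Sub [:: 0] catalan_seq0.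

Definition catalan_children (c : catalan_seq) : seq catalan_seq :=
  pmap insub (appended (val c)).

Lemma mem_catalan_children (c c' : catalan_seq) :
  (c' \in catalan_children c) = (rcons (val c) (last 0 (val c')) == val c').
Proof.
by rewrite mem_pmap_sub -(mem_appended _ (valP c)) (valP c') andbT.
Qed.

(** Every appended sequence is Catalan, so the partial map into the subtype
    drops none of them; counting children and reading off their labels can be
    done on plain sequences. *)
Lemma catalan_children_val (c : catalan_seq) :
  map val (catalan_children c) = appended (val c).
Proof.
rewrite (pmap_filter (insubK _)); apply/all_filterP/allP => f.
by rewrite -(mem_appended _ (valP c)) => /andP[_ cat_f]; rewrite /= insubT.
Qed.

Theorem proposition4 :
  grows_according_to catalan_inversion_sequences Omega_Cat2.
Proof.
exists catalan_root, catalan_children, (fun c => Cat2_label (val c)); split.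
- apply: generating_tree_unique_parent => //.
  + move=> c; rewrite -(map_inj_uniq val_inj) catalan_children_val.
    by rewrite map_inj_uniq ?iota_uniq //; apply: rcons_injr.
  + move=> c c'; rewrite mem_catalan_children => /eqP c'E.
    exists (size (val c)), (last 0 (val c')).
    by rewrite leqnn take_size drop_size cats1 c'E.
  + move=> c1 c2 c'; rewrite !mem_catalan_children => /eqP eq1 /eqP eq2.
    by apply: val_inj; apply: (@rcons_injl _ (last 0 (val c'))); rewrite eq1.
  + move=> [f cat_f] /=; case/lastP: f cat_f => [|e x] //= cat_ex.
    rewrite size_rcons ltnS => e_gt0.
    have := cat_ex; rewrite catalan_rcons // => /andP[cat_e _].
    by exists (Sub e cat_e); rewrite mem_catalan_children /= last_rcons.
- by rewrite /= /Cat2_label /max_entry big_seq1.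
- move=> c; rewrite (map_comp Cat2_label val) catalan_children_val.
  by rewrite Cat2_label_appended //; case/andP: (valP c).
Qed.
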